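(* Let $\beta>0$. Suppose $v\in C^1(X)$ and $p_1,\dots,p_m\in C(X)$ satisfy \begin{align*} \nabla v(x)\cdot f(x)+\bar u\sum_{i=1}^m p_i(x) &\le \beta v(x) && \forall x\in X,\\ p_i(x) &\ge \nabla v(x)\cdot G_i(x) && \forall x\in X,\ i=1,\dots,m,\\ p_i(x) &\ge 0 && \forall x\in X,\ i=1,\dots,m,\\ v(x) &\ge 1 && \forall x\in X_T,\\ v(x) &\ge -1 && \forall x\in X. \end{align*} Then $X_0\subset\{x : v(x)>0\}$.
   Context: Consider the control system $\dot x(t)=f(x(t))+G(x(t))u(t)$, where $f:\mathbb{R}^n\to\mathbb{R}^n$ and $G:\mathbb{R}^n\to\mathbb{R}^{n\times m}$ have polynomial entries and $G_i$ denotes the $i$-th column of $G$. The state constraint set is $X=\{x\in\mathbb{R}^n: g_X(x)>0\}$ with $g_X$ a polynomial such that $\bar X=\{x\in\mathbb{R}^n: g_X(x)\ge 0\}$ is compact. The input constraint set is $U=[0,\bar u]^m$ with $\bar u\ge 0$. The target set is $X_T=\{x\in\mathbb{R}^n: g_T(x)>0\}\subset X$ with $g_T$ a polynomial. The region of attraction $X_0$ is the set of all $x_0\in\mathbb{R}^n$ for which there exist $\tau\in[0,\infty)$, a measurable $u(\cdot)$ and an absolutely continuous $x(\cdot)$ on $[0,\tau]$ such that $\dot x(t)=f(x(t))+G(x(t))u(t)$ for almost every $t\in[0,\tau]$, $x(t)\in X$ and $u(t)\in U$ for all $t\in[0,\tau]$, $x(0)=x_0$, and $x(\tau)\in X_T$.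 $C(X)$ and $C^1(X)$ denote the continuous and the once continuously differentiable real-valued functions on $X$. *)

(* Defs.v *)
From mathcomp Require Import all_boot all_order all_algebra.
From mathcomp Require Import all_classical all_reals all_analysis.
From mathcomp Require Import measurable_realfun.
(* Not imported: the notations of mpoly clash with those of MathComp-Analysis. *)
From mathcomp Require mpoly.
Import Order.TTheory GRing.Theory Num.Theory.
Import numFieldNormedType.Exports.

Set Implicit Arguments.
Unset Strict Implicit.
Unset Printing Implicit Defensive.

Local Open Scope classical_set_scope.
Local Open Scope ring_scope.

Definition poly_eval (R : realType) (n : nat) (q : mpoly.mpoly n R)
    (x : 'cV[R]_n) : R :=
  mpoly.meval (fun i => x i 0) q.

Definition polymx_eval (R : realType) (n k l : nat)
    (Q : 'M[mpoly.mpoly n R]_(k, l)) (x : 'cV[R]_n) : 'M[R]_(k, l) :=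
  map_mx (fun q => poly_eval q x) Q.

Definition pos_set (R : realType) (n : nat) (q : mpoly.mpoly n R) :
    set 'cV[R]_n :=
  [set x | 0 < poly_eval q x].

Definition nonneg_set (R : realType) (n : nat) (q : mpoly.mpoly n R) :
    set 'cV[R]_n :=
  [set x | 0 <= poly_eval q x].

Definition box (R : realType) (m : nat) (ubar : R) : set 'cV[R]_m :=
  [set w | forall i, 0 <= w i 0 <= ubar].

Definition dot (R : realType) (n : nat) (a b : 'cV[R]_n) : R :=
  \sum_(i < n) a i 0 * b i 0.

Definition grad (R : realType) (n : nat) (v : 'cV[R]_n -> R) (x : 'cV[R]_n) :
    'cV[R]_n :=
  \col_i 'D_(delta_mx i 0) v x.

(* Functions on X are represented by total functions whose values outside X
   are irrelevant; [C1_on] is meant for an open X. *)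
Definition C0_on (R : realType) (n : nat) (X : set 'cV[R]_n)
    (p : 'cV[R]_n -> R) : Prop :=
  {within X, continuous p}.

Definition C1_on (R : realType) (n : nat) (X : set 'cV[R]_n)
    (v : 'cV[R]_n -> R) : Prop :=
  (forall x, X x -> differentiable v x) /\ {within X, continuous (grad v)}.

(* The library's norm on 'cV[R]_n is the maximum norm. *)
Definition absolutely_continuous_on (R : realType) (n : nat) (a b : R)
    (x : R -> 'cV[R]_n) : Prop :=
  forall e : R, 0 < e -> exists2 d : R, 0 < d &
    forall (k : nat) (s t : 'I_k -> R),
      (forall i, a <= s i /\ s i <= t i /\ t i <= b) ->
      trivIset setT (fun i => `]s i, t i[%classic) ->
      \sum_(i < k) (t i - s i) < d ->
      \sum_(i < k) `|x (t i) - x (s i)| < e.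

(* Measurability with respect to the Lebesgue sigma-algebra (the completion of
   the Borel one) on the domain and the Borel sigma-algebra on the codomain;
   the canonical sigma-algebra on R is the Borel one. *)
Definition lebesgue_measurable_on (R : realType) (D : set R) (h : R -> R) :
    Prop :=
  @measurable_fun _ _
    (g_sigma_algebraType (completed_algebra_gen (@lebesgue_measure R)))
    (measurableTypeR R) D h.

(* The two-sided derivative at the endpoints of [0, tau] depends on the values
   of x outside [0, tau], but the endpoints form a null set. *)
Definition region_of_attraction (R : realType) (n m : nat)
    (f : 'cV[R]_n -> 'cV[R]_n) (G : 'cV[R]_n -> 'M[R]_(n, m))
    (X : set 'cV[R]_n) (U : set 'cV[R]_m) (XT : set 'cV[R]_n) :
    set 'cV[R]_n :=
  [set x0 | exists (tau : R) (u : R -> 'cV[R]_m) (x : R -> 'cV[R]_n),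
    0 <= tau /\
    (forall i, lebesgue_measurable_on `[0, tau] (fun t => u t i 0)) /\
    absolutely_continuous_on 0 tau x /\
    {ae (@lebesgue_measure R), forall t : R, t \in `[0, tau] ->
      is_derive t (1 : R) x (f (x t) + G (x t) *m u t)} /\
    (forall t : R, t \in `[0, tau] -> X (x t) /\ U (u t)) /\
    x 0 = x0 /\
    XT (x tau)].

(* Main.v *)
(* Along an admissible trajectory the constraints give (v o x)' <= beta (v o x)
   almost everywhere, so W(t) = exp(-beta t) v(x(t)) has W' <= 0 almost
   everywhere; hence v(x(0)) = W(0) >= W(tau) >= exp(-beta tau) > 0.
   That W is nonincreasing is proved without integration, by a Cousin-type
   covering argument on [0, tau]: a differentiability point has a neighbourhood
   in which W grows with slope at most e, while the exceptional null set lies in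
   an open set so small that, by absolute continuity of x and a Lipschitz bound
   on v along the compact trajectory, W varies little on it. *)
Require Import Defs.
From mathcomp Require Import all_boot all_order all_algebra.
From mathcomp Require Import all_classical all_reals all_analysis.
From mathcomp Require Import measurable_realfun.
From mathcomp Require mpoly.
From mathcomp Require Import lra ring.
Import Order.TTheory GRing.Theory Num.Theory.
Import numFieldNormedType.Exports.

Local Open Scope classical_set_scope.
Local Open Scope ring_scope.

(** * Gauges on a compact interval and monotonicity *)

(** The straddle lemma: the increments from [s] to [c] and from [c] to [t] deviate from the tangent
    by at most [e] times their lengths, and as [c] lies between [s] and [t] these lengths add up to
    [t - s]. *)
Lemma is_derive_straddle (R : realType) (W : R -> R) (c d e : R) :
  is_derive c 1 W d -> 0 < e ->
  exists2 r, 0 < r & forall s t, s <= c <= t -> c - s < r -> t - c < r ->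
    W t - W s <= (d + e) * (t - s).
Proof.
move=> [dW Wd] e0.
have cvgq : (fun h => h^-1 *: (W (h *: 1 + c) - W c)) @ 0^' --> d.
  by rewrite -Wd; exact: dW.
move/cvgrPdist_lt/(_ _ e0): cvgq => -[r /= r0 Hr].
have Hq h : `|h| < r -> `|W (h + c) - W c - d * h| <= e * `|h|.
  (* The limit of the difference quotients only covers nonzero [h]. *)
  have [->|h0] := eqVneq h 0.
    by rewrite add0r subrr mulr0 subr0 normr0 mulr0.
  move=> hr; have := Hr h; rewrite /= sub0r normrN => /(_ hr h0).
  rewrite /GRing.scale /= mulr1.
  move=> /ltW; rewrite -(@ler_pM2r _ `|h|) ?normr_gt0 // -normrM.
  by rewrite distrC mulrBl mulrAC mulVf // mul1r.
exists r => // s t /andP[sc ct] sr tr.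
have := Hq (t - c); rewrite subrK ger0_norm ?subr_ge0 // => /(_ tr).
have := Hq (s - c); rewrite subrK ler0_norm ?subr_le0 // opprB => /(_ sr).
rewrite !ler_norml => /andP[? ?] /andP[? ?]; lra.
Qed.

(** A form of Cousin's lemma: the step at the supremum of the points satisfying [P] starts from such
    a point just below it and would pass beyond it unless it is [b]. *)
Lemma gauge_induction (R : realType) (a b : R) (P : R -> Prop) :
  a <= b -> P a ->
  (forall c, a <= c <= b -> exists2 r, 0 < r & forall s t,
    a <= s <= c -> c <= t <= b -> c - s < r -> t - c < r -> P s -> P t) ->
  P b.
Proof.
move=> ab Pa step.
pose S := [set y | a <= y <= b /\ P y].
have Sa : S a by split => //; rewrite lexx.
have ubS : ubound S b by move=> y [/andP[]].
have supS : has_sup S by split; [exists a|exists b].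
have ac : a <= sup S by apply: ub_le_sup => //; exists b.
have cb : sup S <= b by apply: ge_sup => //; exists a.
have [|r r0 Hr] := step (sup S); first by rewrite ac.
have [s [/andP[s1 s2] Ps] sS] := sup_adherent r0 supS.
have sc : s <= sup S.
  by apply: ub_le_sup => //; [exists b|split=> //; rewrite s1].
pose y := Num.min b (sup S + r / 2).
have cy : sup S <= y by rewrite le_min cb lerDl divr_ge0 // ltW.
have yb : y <= b by rewrite ge_min lexx.
have yr : y <= sup S + r / 2 by rewrite ge_min lexx orbT.
have Py : P y.
  by apply: (Hr s) => //; rewrite ?s1 ?cy //; lra.
have : y <= sup S.
  by apply: ub_le_sup; [exists b|split=> //; rewrite (le_trans ac)].
rewrite ge_min => /orP[bc|]; last by move=> ?; exfalso; lra.
by rewrite (_ : b = y) //; apply/eqP; rewrite eq_le yb (le_trans bc).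
Qed.

(** Take for [F y] the measure of the part up to [y] of an open set [V] containing [N], of measure
    below [e]. Around a point of [N] a whole interval lies in [V], so there [F] grows by the full
    length. *)
Lemma negligible_gauge (R : realType) (N : set R) (e : R) :
  (@lebesgue_measure R).-negligible N -> 0 < e ->
  exists F : R -> R, [/\ forall y, 0 <= F y < e,
    {homo F : y z / y <= z} &
    forall c, N c -> exists2 r, 0 < r & forall s t, s <= c <= t ->
      c - s < r -> t - c < r -> t - s <= F t - F s].
Proof.
move=> [A [mA A0 NA]] e0.
have Aoo : (lebesgue_measure A < +oo)%E by rewrite [X in (X < _)%E]A0.
have [V [oV AV mVe]] := lebesgue_regularity_outer mA Aoo e0.
pose mu := @lebesgue_measure R.
have mA0 : mu A = 0%E by [].
have mV : measurable V by exact: open_measurable.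
have mVy y : measurable (V `&` `]-oo, y]) by apply: measurableI.
(* Outer regularity bounds the measure of [V] minus [A], and [A] is null. *)
have Ve : (mu V < e%:E)%E.
  apply: le_lt_trans mVe; rewrite -/mu -[leRHS]adde0 -[X in (_ + X)%E]mA0.
  rewrite -{1}(setDUK AV) setUC; apply: measureU2 => //.
  exact: measurableD.
have Vye y : (mu (V `&` `]-oo, y]) < e%:E)%E.
  apply: le_lt_trans Ve; apply: le_measure; rewrite ?inE.
  - exact: mVy.
  - exact: mV.
  - exact: subIsetl.
have fV y : mu (V `&` `]-oo, y]) \is a fin_num.
  by rewrite ge0_fin_numE // (lt_trans (Vye y)) // ltry.
exists (fun y => fine (mu (V `&` `]-oo, y]))); split.
- move=> y; rewrite fine_ge0 //=.
  by rewrite -lte_fin fineK.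
- move=> y z yz; apply: fine_le => //; apply: le_measure; rewrite ?inE.
  - exact: mVy.
  - exact: mVy.
  - by apply: setIS => w /=; rewrite !in_itv /= => /le_trans; exact.
move=> c Nc; have /= [r r0 Hr] := oV _ (AV _ (NA _ Nc)).
exists r => // s t /andP[sc ct] sr tr.
rewrite lerBrDr -lee_fin EFinD !fineK // addeC.
(* The half-open []s, t]] is disjoint from []-oo, s]], so additivity reduces the claim to an
   inclusion of sets. *)
have -> : ((t - s)%:E = mu `]s, t]%classic)%E.
  rewrite /mu lebesgue_measure_itv /= lte_fin.
  case: ltP => // ts; rewrite (_ : t = s) ?subrr //.
  by apply/eqP; rewrite eq_le ts (le_trans sc ct).
rewrite -measureU; first last.
- apply/seteqP; split => // w [[_] /=]; rewrite !in_itv /= => ws /andP[].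
  by rewrite ltNge ws.
- by [].
- exact: mVy.
apply: le_measure; rewrite ?inE.
- by apply: measurableU => //; exact: mVy.
- exact: mVy.
move=> w [[Vw]|]; rewrite /= !in_itv /= => ws.
  by split => //=; rewrite (le_trans ws)// (le_trans sc).
move/andP: ws => [sw wt]; split; last by [].
by apply: Hr => /=; rewrite ltr_distlC; apply/andP; split; lra.
Qed.

(* The points outside [N] contribute at most [e * (b - a)], and the gauge makes
   the intervals used at points of [N] short enough in total for absolute
   continuity to apply. *)
Lemma absolutely_continuous_le (R : realType) (n : nat) (a b L : R)
    (x : R -> 'cV[R]_n) (W : R -> R) (N : set R) :
  a <= b -> 0 <= L -> absolutely_continuous_on a b x ->
  (@lebesgue_measure R).-negligible N ->
  (forall c, a <= c <= b -> exists2 r, 0 < r & forall s t,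
    a <= s <= c -> c <= t <= b -> c - s < r -> t - c < r ->
    W t - W s <= L * (`|x t - x s| + (t - s))) ->
  (forall c, a <= c <= b -> ~ N c -> forall e, 0 < e ->
    exists2 r, 0 < r & forall s t, s <= c <= t -> c - s < r -> t - c < r ->
    W t - W s <= e * (t - s)) ->
  W b <= W a.
Proof.
move=> ab L0 acx Nnull bad good.
(* The three terms in [e] are the slope off [N], the variation of [x] over the intervals used at
   points of [N], and the total length of these intervals. *)
have small e : 0 < e -> W b - W a <= e * (b - a) + L * (e + e).
  move=> e0; have [d d0 Hd] := acx _ e0.
  have de0 : 0 < Num.min d e by rewrite lt_min d0.
  have [F [F0 ndF HF]] := negligible_gauge _ _ _ Nnull de0.
  (* Induction invariant: [s] and [t] list in order the intervals used so far at points of [N],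
     whose total length is paid for by [F]. *)
  pose P y := exists (k : nat) (s t : nat -> R), [/\
    forall i, (i < k)%N -> a <= s i <= t i /\ t i <= y,
    forall i j, (i < j < k)%N -> t i <= s j,
    \sum_(i < k) (t i - s i) <= F y &
    W y - W a <= e * (y - a) +
      L * (\sum_(i < k) `|x (t i) - x (s i)| + \sum_(i < k) (t i - s i))].
  have : P b.
    apply: (gauge_induction _ _ _ _ ab).
      exists 0%N, (fun=> 0), (fun=> 0).
      split.
      - by [].
      - by move=> i j /andP[_]; rewrite ltn0.
      - by rewrite big_ord0; case/andP: (F0 a).
      - by rewrite !big_ord0 !subrr mulr0 addr0 mulr0 addr0.
    move=> c cab; have [Nc|Nc] := pselect (N c); last first.
      have [r r0 Hr] := good _ cab Nc _ e0.
      exists r => // u z /andP[au uc] /andP[cz zb] ur zr.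
      move=> [k [s [t [st dis sF Wu]]]].
      have uz : u <= z by exact: le_trans cz.
      exists k, s, t; split => //.
      - by move=> i ik; have [? tu] := st _ ik; split=> //; exact: le_trans uz.
      - by rewrite (le_trans sF)// ndF.
      - have := Hr u z; rewrite uc cz => /(_ isT ur zr) Wzu.
        move: Wu Wzu; set S := L * _; lra.
    have [r1 r10 Hr1] := bad _ cab.
    have [r2 r20 Hr2] := HF _ Nc.
    exists (Num.min r1 r2); first by rewrite lt_min r10.
    move=> u z /andP[au uc] /andP[cz zb].
    rewrite !lt_min => /andP[ur1 ur2] /andP[zr1 zr2].
    move=> [k [s [t [st dis sF Wu]]]].
    have uz : u <= z by exact: le_trans cz.
    (* At a point of [N] the interval [[u, z]] is appended to the list; [F z - F u] covers its
       length. *)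
    pose s' i := if i == k then u else s i.
    pose t' i := if i == k then z else t i.
    have sumE (g : R -> R -> R) : \sum_(i < k.+1) g (s' i) (t' i) =
        \sum_(i < k) g (s i) (t i) + g u z.
      rewrite big_ord_recr /= /s' /t' eqxx; congr (_ + _).
      by apply: eq_bigr => i _; rewrite ltn_eqF.
    exists k.+1, s', t'; split.
    - move=> i; rewrite ltnS leq_eqVlt /s' /t'; case: eqP => /= [_ _|_ ik].
        by rewrite au uz.
      by have [? tu] := st _ ik; split=> //; exact: le_trans uz.
    - move=> i j /andP[ij]; rewrite ltnS leq_eqVlt /s' /t' => /orP[/eqP jk|jk].
        subst j; rewrite eqxx ltn_eqF //; by have [] := st _ ij.
      by rewrite !ltn_eqF // ?(ltn_trans ij) //; apply: dis; rewrite ij.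
    - rewrite (sumE (fun p q => q - p)).
      have := Hr2 u z; rewrite uc cz => /(_ isT ur2 zr2); lra.
    - rewrite (sumE (fun p q => q - p)) (sumE (fun p q => `|x q - x p|)).
      have := Hr1 u z; rewrite au uc cz zb => /(_ isT isT ur1 zr1).
      have : 0 <= e * (z - u) by rewrite mulr_ge0 ?subr_ge0 // ltW.
      move: Wu; set S1 := \sum_(_ < _) _; set S2 := \sum_(_ < _) _; lra.
  move=> [k [s [t [st dis sF Wb]]]].
  have [_] := andP (F0 b); rewrite lt_min => /andP[Fd Fe].
  have := Hd k (fun i => s i) (fun i => t i).
  have -> : \sum_(i < k) (t i - s i) < d by exact: le_lt_trans Fd.
  move=> H.
  have Se : \sum_(i < k) `|x (t i) - x (s i)| < e.
    apply: H => //.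
      by move=> i; have [/andP[? ?] ?] := st _ (ltn_ord i).
    apply/trivIsetP => i j _ _ ij.
    wlog : i j ij / (i < j)%N.
      move=> Hw; case: (ltngtP i j) => ij'; first exact: Hw.
        by rewrite setIC; apply: Hw => //; rewrite eq_sym.
      by move/eqP: ij; case; apply/val_inj.
    move=> ij'; apply/seteqP; split=> // w [] /=; rewrite !in_itv /=.
    move=> /andP[_ wt] /andP[sw _].
    have : t i <= s j by apply: dis; rewrite ij' /=.
    by rewrite leNgt (lt_trans sw wt).
  apply: (le_trans Wb); rewrite lerD2l ler_wpM2l // lerD // ltW //.
  exact: le_lt_trans Fe.
rewrite -subr_le0; apply/ler_addgt0Pr => e e0.
(* With [e / K] for [e], the bound [small] falls below [e]; the summand 1 keeps [K] positive. *)
pose K := b - a + 2 * L + 1.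
have K0 : 0 < K by rewrite ltr_wpDl // addr_ge0 ?subr_ge0 // mulr_ge0.
have eK : e / K * K = e by rewrite divfK // gt_eqF.
have eK0 : 0 < e / K by rewrite divr_gt0.
apply: (le_trans (small _ eK0)).
by rewrite add0r -[leRHS]eK /K; nra.
Qed.

(** * Polynomial superlevel sets *)

Lemma poly_eval_continuous (R : realType) (n : nat) (q : mpoly.mpoly n R) :
  continuous (poly_eval q).
Proof.
rewrite (_ : poly_eval q = fun x => \sum_(m <- mpoly.msupp q)
  mpoly.mcoeff m q * \prod_i x i 0 ^+ mpoly.fun_of_multinom m i); last first.
  by apply/funext => y; rewrite /poly_eval mpoly.mevalE.
have addc : continuous (fun z : R * R => z.1 + z.2)
  by move=> z; exact: (@add_continuous R z).
have mulc : continuous (fun z : R * R => z.1 * z.2).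
  by move=> z; exact: (@mul_continuous R z).
have prodc (k : 'I_n -> nat) :
    continuous (fun x : 'cV[R]_n => \prod_i x i 0 ^+ k i).
  apply: (continuous_big mulc) => i _ x.
  apply: (continuous_comp (f := fun y : 'cV[R]_n => y i 0)
    (g := fun z : R => z ^+ _)); first exact: coord_continuous.
  exact: exprn_continuous.
apply: (continuous_big addc) => m _ x.
by apply: continuousM; [exact: cst_continuous|exact: prodc].
Qed.

Lemma pos_set_open (R : realType) (n : nat) (q : mpoly.mpoly n R) :
  open (pos_set q).
Proof.
rewrite (_ : pos_set q = poly_eval q @^-1` [set y | 0 < y]) //.
apply: open_comp; last exact: open_gt.
by move=> x _; exact: (poly_eval_continuous R n).
Qed.

(** * Gradients and local Lipschitz bounds *)

(** Makes the linearity of the differential available for [dot (grad v x)]. *)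
Lemma diff_grad (R : realType) (n : nat) (v : 'cV[R]_n -> R) (x w : 'cV[R]_n) :
  differentiable v x -> 'd v x w = dot (grad v x) w.
Proof.
move=> dv; have -> : w = \sum_i w i 0 *: delta_mx i 0.
  by rewrite {1}(matrix_sum_delta w); apply: eq_bigr => i _; rewrite big_ord1.
rewrite linear_sum /dot; apply: eq_bigr => i _.
rewrite linearZ /= mxE deriveE // mulrC; congr (_ * _).
rewrite summxE (bigD1 i) //= big1 ?addr0; last first.
  by move=> j ji; rewrite !mxE eq_sym (negbTE ji) mulr0.
by rewrite !mxE !eqxx mulr1.
Qed.

(** The factor [n] comes from the maximum norm: each of the [n] products is at most the product of
    the norms. *)
Lemma dot_le_norm (R : realType) (n : nat) (a b : 'cV[R]_n) :
  `|dot a b| <= n%:R * `|a| * `|b|.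
Proof.
have coord (c : 'cV[R]_n) i : `|c i 0| <= `|c|.
  by rewrite [leRHS]/Num.norm /= mx_normrE (le_bigmax _ _ (i, 0)).
apply: (le_trans (ler_norm_sum _ _ _)).
apply: (@le_trans _ _ (\sum_(i < n) `|a| * `|b|)).
  by apply: ler_sum => i _; rewrite normrM ler_pM.
by rewrite sumr_const card_ord -[leLHS]mulr_natl mulrA.
Qed.

(** By continuity the gradient stays below [M] on a ball around [z]; the mean value theorem applies
    on any segment in this convex ball. *)
Lemma C1_on_lipschitz_near (R : realType) (n : nat) (X : set 'cV[R]_n)
    (v : 'cV[R]_n -> R) (z : 'cV[R]_n) (M : R) :
  open X -> C1_on X v -> X z -> `|grad v z| < M ->
  exists2 r, 0 < r & forall y w, `|z - y| < r -> `|z - w| < r ->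
    `|v w - v y| <= n%:R * M * `|w - y|.
Proof.
move=> oX [dv cv] Xz gM.
have cvz : {for z, continuous (grad v)}.
  by move: cv; rewrite (continuous_open_subspace _ oX); apply; rewrite inE.
have /nbhs_normP[r /= r0 Hr] : \forall y \near z, X y /\ `|grad v y| < M.
  near=> y; split; near: y; first exact: oX.
  have /cvgrPdist_lt/(_ (M - `|grad v z|)) := cvz.
  rewrite subr_gt0 => /(_ gM); apply: filterS => y.
  rewrite distrC => H; have := ler_normD (grad v y - grad v z) (grad v z).
  rewrite subrK; lra.
have {}Hr y : `|z - y| < r -> X y /\ `|grad v y| < M.
  by move=> zy; exact: Hr.
exists r => // y w zy zw.
pose g (s : R) := y + s *: (w - y).
have Hg (s : R) : 0 <= s <= 1 -> `|z - g s| < r.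
  move=> /andP[s0 s1].
  have -> : z - g s = (1 - s) *: (z - y) + s *: (z - w).
    rewrite /g !scalerBr !scalerBl !scale1r.
    by apply/matrixP => i j; rewrite !mxE; ring.
  apply: (le_lt_trans (ler_normD _ _)).
  rewrite !normrZ (ger0_norm s0) ger0_norm ?subr_ge0 //.
  have : 0 <= (1 - s) * (r - `|z - y|) by rewrite mulr_ge0 ?subr_ge0 // ltW.
  (* For [s] nonzero, strictness comes from the weight of [z - w]. *)
  have [->|s0'] := eqVneq s 0; first by move=> *; rewrite mul0r; lra.
  have : 0 < s * (r - `|z - w|).
    by rewrite mulr_gt0 ?subr_gt0 // lt_neqAle eq_sym s0'.
  lra.
have dg (s : R) : is_diff s g (fun h => h *: (w - y)).
  have := is_diffD (is_diff_cst y s) (is_diff_scalel s (w - y)).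
  by rewrite add0r.
have dh (s : R) : 0 <= s <= 1 ->
    is_derive s 1 (v \o g) (dot (grad v (g s)) (w - y)).
  move=> /Hg /Hr[Xg _].
  have dvg : differentiable (v \o g) s.
    apply: differentiable_comp; last exact: dv.
    by case: (dg s).
  apply: DeriveDef; first by apply/derivable1_diffP.
  rewrite deriveE // diff_comp //=; last exact: dv.
  by rewrite diff_val scale1r diff_grad //; exact: dv.
have [c c01] : exists2 c : R, c \in `[0, 1] &
    (v \o g) 1 - (v \o g) 0 = dot (grad v (g c)) (w - y) * (1 - 0).
  apply: MVT_segment => //.
    move=> s; rewrite in_itv /= => /andP[s0 s1].
    by apply: dh; rewrite !ltW.
  apply: derivable_within_continuous => s; rewrite in_itv /= => s01.
  by case: (dh s s01).
rewrite subr0 mulr1 /= /g scale0r addr0 scale1r [y + _]addrC subrK => ->.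
apply: (le_trans (dot_le_norm _ _ _ _)).
rewrite ler_wpM2r // ler_wpM2l //.
by move: c01; rewrite in_itv /= => /Hg /Hr[_ /ltW].
Unshelve. all: by end_near.
Qed.

(** * Estimates along trajectories *)

(** Uniform continuity is the case of a single interval. *)
Lemma absolutely_continuous_on_dist (R : realType) (n : nat) (a b : R)
    (x : R -> 'cV[R]_n) :
  absolutely_continuous_on a b x ->
  forall e, 0 < e -> exists2 d, 0 < d &
    forall s t, a <= s <= b -> a <= t <= b ->
    `|t - s| < d -> `|x t - x s| < e.
Proof.
move=> acx e e0; have [d d0 Hd] := acx _ e0; exists d => // s t.
wlog st : s t / s <= t.
  move=> Hw sab tab; case: (leP s t) => [st|/ltW ts]; first exact: Hw.
  by rewrite distrC [X in _ -> X < _]distrC; exact: Hw.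
move=> /andP[sa sb] /andP[ta tb]; rewrite ger0_norm ?subr_ge0 // => std.
have := Hd 1%N (fun=> s) (fun=> t); rewrite !big_ord1; apply => //.
by apply/trivIsetP => i j _ _; rewrite !ord1 eqxx.
Qed.

(** Factor out [expR (- k * s)], which is at most 1, and use [1 - expR (- h) <= h] with
    [h = k * (t - s)]. *)
Lemma expRNM_lipschitz (R : realType) (k s t : R) : 0 <= k -> 0 <= s <= t ->
  0 <= expR (- k * s) - expR (- k * t) <= k * (t - s).
Proof.
move=> k0 /andP[s0 st].
have kd0 : 0 <= k * (t - s) by rewrite mulr_ge0 ?subr_ge0.
have -> : - k * t = - k * s - k * (t - s) by ring.
rewrite expRD -{1 3}[expR (- k * s)]mulr1 -mulrBr.
have E1 : expR (- k * s) <= 1.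
  by rewrite -[leRHS]expR0 ler_expR mulNr oppr_le0 mulr_ge0.
have E2 : expR (- (k * (t - s))) <= 1.
  by rewrite -[leRHS]expR0 ler_expR oppr_le0.
apply/andP; split; first by rewrite mulr_ge0 ?expR_ge0 // subr_ge0.
apply: (@le_trans _ _ (1 - expR (- (k * (t - s))))).
  by rewrite ler_piMl // subr_ge0.
by have := expR_ge1Dx (- (k * (t - s))); lra.
Qed.

Lemma is_derive_expRNM (R : realType) (k c : R) (V : R -> R) (d : R) :
  is_derive c 1 V d ->
  is_derive c 1 (fun t => expR (- k * t) * V t)
    (expR (- k * c) * (d - k * V c)).
Proof.
move=> dV.
have dk := is_deriveZ (- k) (is_derive_id c 1).
have dE := is_derive1_comp (is_derive_expR (- k * c)) dk.
apply: is_derive_eq (is_deriveM dE dV) _.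
by rewrite /GRing.scale /=; ring.
Qed.

Lemma is_derive_comp_grad (R : realType) (n : nat) (v : 'cV[R]_n -> R)
    (x : R -> 'cV[R]_n) (c : R) (w : 'cV[R]_n) :
  differentiable v (x c) -> is_derive c 1 x w ->
  is_derive c 1 (v \o x) (dot (grad v (x c)) w).
Proof.
move=> dv dx.
have dxc : differentiable x c by apply/derivable1_diffP; case: dx.
have dvx : differentiable (v \o x) c by exact: differentiable_comp.
apply: DeriveDef; first by apply/derivable1_diffP.
rewrite deriveE // diff_comp //= -diff_grad //; congr ('d v _ _).
by rewrite -deriveE //; case: dx.
Qed.

(** * Decay of the weighted value along an admissible trajectory *)

Theorem lemma1 (R : realType) (n m : nat)
    (f : 'cV[mpoly.mpoly n R]_n) (G : 'M[mpoly.mpoly n R]_(n, m))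
    (gX gT : mpoly.mpoly n R) (ubar : R)
    (X_compact : compact (nonneg_set gX))
    (ubar_ge0 : 0 <= ubar)
    (XT_sub_X : pos_set gT `<=` pos_set gX)
    (beta : R) (beta_gt0 : 0 < beta)
    (v : 'cV[R]_n -> R) (p : 'I_m -> 'cV[R]_n -> R)
    (v_C1 : C1_on (pos_set gX) v)
    (p_C0 : forall i, C0_on (pos_set gX) (p i))
    (v_decay : forall x, pos_set gX x ->
      dot (grad v x) (polymx_eval f x) + ubar * \sum_(i < m) p i x
        <= beta * v x)
    (p_ge_grad : forall x, pos_set gX x -> forall i,
      p i x >= dot (grad v x) (col i (polymx_eval G x)))
    (p_ge0 : forall x, pos_set gX x -> forall i, p i x >= 0)
    (v_ge1 : forall x, pos_set gT x -> v x >= 1)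
    (v_geN1 : forall x, pos_set gX x -> v x >= -1) :
  region_of_attraction (polymx_eval f) (polymx_eval G)
      (pos_set gX) (box ubar) (pos_set gT)
    `<=` pos_set gX `&` [set x | 0 < v x].
Proof.
move=> x0 [tau [u [x [tau0 [_ [acx [aex [XU [<- xT]]]]]]]]].
have Xx t : 0 <= t <= tau -> pos_set gX (x t).
  by move=> tt; have [] := XU t; rewrite ?in_itv.
split; first by apply: Xx; rewrite lexx.
have oX := pos_set_open _ _ gX.
have cx := absolutely_continuous_on_dist _ _ _ _ _ acx.
(* The gradient is continuous along the trajectory, so its norm attains a maximum on [[0, tau]];
   adding 1 makes the bound strict. *)
have [M M0 gM] : exists2 M : R, 0 <= M &
    forall t, 0 <= t <= tau -> `|grad v (x t)| < M.
  have [c _ Hc] : exists2 c, c \in `[0, tau] &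
      forall t, t \in `[0, tau] -> `|grad v (x t)| <= `|grad v (x c)|.
    apply: (EVT_max (f := fun t => `|grad v (x t)|)) => //.
    apply/subspace_continuousP => t t01; apply: cvg_norm.
    have Xt : pos_set gX (x t) by apply: Xx; move: t01; rewrite /= in_itv.
    have cvt : {for x t, continuous (grad v)}.
      case: v_C1 => _; rewrite (continuous_open_subspace _ oX); apply.
      by rewrite inE.
    apply: (cvg_comp x (grad v) _ cvt).
    apply/cvgrPdist_lt => e e0; have [r r0 Hr] := cx e e0.
    apply/nbhs_ballP; exists r => //= y ty y01.
    rewrite distrC; apply: Hr.
    - by move: y01; rewrite in_itv.
    - by move: t01; rewrite /= in_itv.
    - by rewrite distrC.
  exists (`|grad v (x c)| + 1); first by rewrite addr_ge0.
  by move=> t tt; rewrite ltr_pwDr // Hc // in_itv.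
(* Columnwise, [u_i] times the derivative of [v] along [G_i] is at most [u_i * p_i], hence at most
   [ubar * p_i], by [0 <= u_i <= ubar] and [p_i >= 0]. *)
have v_decay_u t : 0 <= t <= tau ->
    dot (grad v (x t)) (polymx_eval f (x t) + polymx_eval G (x t) *m u t)
      <= beta * v (x t).
  move=> tt; have Xt := Xx _ tt; apply: le_trans (v_decay _ Xt).
  have -> : polymx_eval G (x t) *m u t =
      \sum_i u t i 0 *: col i (polymx_eval G (x t)).
    apply/colP => j; rewrite !mxE summxE; apply: eq_bigr => i _.
    by rewrite !mxE mulrC.
  have dvx : differentiable v (x t) by case: v_C1 => + _; apply.
  rewrite -diff_grad // linearD /= !diff_grad // lerD2l.
  rewrite -diff_grad // linear_sum mulr_sumr; apply: ler_sum => i _.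
  rewrite linearZ /= diff_grad //.
  have [|_ /(_ i) /andP[u0 uu]] := XU t; first by rewrite in_itv.
  apply: (@le_trans _ _ (u t i 0 * p i (x t))).
    by rewrite /GRing.scale /= ler_wpM2l // p_ge_grad.
  by rewrite ler_wpM2r // p_ge0.
pose W t := expR (- beta * t) * v (x t).
have WW : W tau <= W 0.
  (* In this constant [n%:R * M] accounts for [v] along [x], and [beta] for the exponential
     weight. *)
  have L0 : 0 <= n%:R * M + beta by rewrite addr_ge0 ?mulr_ge0 // ltW.
  apply: (absolutely_continuous_le _ _ _ _ _ _ _ _ tau0 L0 acx aex).
  - move=> c cc.
    have [r r0 Hr] :=
      C1_on_lipschitz_near _ _ _ _ _ _ oX v_C1 (Xx _ cc) (gM _ cc).
    have [d d0 Hd] := cx _ r0.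
    exists d => // s t /andP[s0 sc] /andP[ct tT] sd td.
    have st : s <= t := le_trans sc ct.
    have ss : 0 <= s <= tau by rewrite s0 (le_trans st).
    have tt : 0 <= t <= tau by rewrite (le_trans s0).
    have Hv : `|v (x t) - v (x s)| <= n%:R * M * `|x t - x s|.
      apply: Hr; apply: Hd => //.
        by rewrite ger0_norm ?subr_ge0.
      by rewrite distrC ger0_norm ?subr_ge0.
    have b0 : 0 <= beta by exact: ltW.
    have /andP[E0 E1] :
        0 <= expR (- beta * s) - expR (- beta * t) <= beta * (t - s).
      by apply: expRNM_lipschitz; rewrite ?s0.
    have Et : expR (- beta * t) <= 1.
      rewrite -[leRHS]expR0 ler_expR mulNr oppr_le0 mulr_ge0 //.
      exact: le_trans st.
    have A1 : expR (- beta * t) * (v (x t) - v (x s))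
        <= n%:R * M * `|x t - x s|.
      apply: le_trans Hv; apply: (le_trans (ler_norm _)).
      by rewrite normrM ger0_norm ?expR_ge0 // ler_piMl.
    (* The increment of [W] contains [v (x s)] times the negative change of the weight; [v >= -1]
       bounds this term by the decrease of the weight. *)
    have A2 : 0 <= (expR (- beta * s) - expR (- beta * t)) * (v (x s) + 1).
      by rewrite mulr_ge0 // -lerBlDr sub0r; exact: v_geN1 (Xx _ ss).
    have A3 : 0 <= n%:R * M * (t - s) by rewrite !mulr_ge0 ?subr_ge0.
    have A4 : 0 <= beta * `|x t - x s| by rewrite mulr_ge0.
    by rewrite /W; lra.
  - move=> c cc Nc e e0.
    have dx : is_derive c 1 x
        (polymx_eval f (x c) + polymx_eval G (x c) *m u c).
      (* The null set is the complement of the set where the differential equation holds, hence the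
         double negation. *)
      apply: contrapT => Nd; apply: Nc => /= H; apply: Nd; apply: H.
      by rewrite in_itv.
    set w := (polymx_eval f (x c) + _) in dx.
    have dvx : differentiable v (x c) by case: v_C1 => + _; apply; exact: Xx.
    have dW := is_derive_expRNM _ beta _ _ _
      (is_derive_comp_grad _ _ _ _ _ _ dvx dx).
    have [r r0 Hr] := is_derive_straddle _ _ _ _ _ dW e0.
    exists r => // s t sct sr tr; apply: (le_trans (Hr _ _ sct sr tr)).
    (* The derivative of [W] at [c] is a positive weight times a quantity made nonpositive by
       [v_decay_u], so the slope is at most [e]. *)
    rewrite ler_wpM2r ?subr_ge0 ?gerDr //.
      by case/andP: sct => /le_trans; apply.
    by rewrite pmulr_rle0 ?expR_gt0 // subr_le0 v_decay_u.
have W0 : W 0 = v (x 0) by rewrite /W mulr0 expR0 mul1r.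
rewrite /= -W0.
apply: lt_le_trans WW; rewrite mulr_gt0 ?expR_gt0 //.
by rewrite (lt_le_trans ltr01) // v_ge1.
Qed.
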